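(* Let $k\neq 0$ be a real constant. Each of the following three equations for $u'(x',t')$ is mapped into the equation $$u_t=\left(\frac{u_x}{u}\right)_x+\frac{1}{xu}u_x$$ by the point transformation listed with it: (i) $\displaystyle u'_{t'}=\left(\frac{u'_{x'}}{u'}\right)_{x'}$, by $x'=k\ln|x|,\ t'=t,\ u'=\frac{1}{k^2}ux^2$; (ii) $\displaystyle u'_{t'}=\left(\frac{u'_{x'}}{u'}\right)_{x'}+\left(\frac{1}{x'u'}+\frac12 x'\right)u'_{x'}$, by $x'=\frac{x^k}{\sqrt t},\ t'=\ln t,\ u'=\frac{1}{k^2}ux^{2(1-k)}$; (iii) $\displaystyle u'_{t'}=\left(\frac{u'_{x'}}{u'}\right)_{x'}+\frac12 x'u'_{x'}$, by $x'=\frac{k\ln|x|}{\sqrt t},\ t'=\ln t,\ u'=\frac{1}{k^2}ux^2$.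
   Context: Subscripts denote partial derivatives. A point transformation $x'=P(x,t)$, $t'=Q(t)$, $u'=R(x,t,u)$ ''maps an equation $E'$ for $u'(x',t')$ into an equation $E$ for $u(x,t)$'' if: whenever $(x,t)\mapsto(P(x,t),Q(t))$ is a diffeomorphism of an open set $D$ onto an open set $D'$, $u$ is a smooth nowhere vanishing function on $D$, and $u'$ is defined on $D'$ by $u'(P(x,t),Q(t))=R(x,t,u(x,t))$, then $u'$ satisfies $E'$ on $D'$ if and only if $u$ satisfies $E$ on $D$. Here $D$ lies in $\{x\ne0\}$ in (i) and (iii), in $\{x>0\}$ in (ii), and in $\{t>0\}$ in (ii) and (iii). *)

(* Defs.v *)
From Stdlib Require Import Reals.
From Coquelicot Require Import Coquelicot.
Open Scope R_scope.

(* Functions of (x, t) are curried and total, subsets of the plane are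
   predicates on R * R.  A function "on D" is a total function of which only
   the values on D matter; since every D below is open, this determines its
   partial derivatives on D. *)

Definition Dx (u : R -> R -> R) : R -> R -> R :=
  fun x t => Derive (fun y => u y t) x.

Definition Dt (u : R -> R -> R) : R -> R -> R :=
  fun x t => Derive (fun s => u x s) t.

Definition smooth_on (D : R * R -> Prop) (u : R -> R -> R) : Prop :=
  forall (n : nat) (x t : R), D (x, t) -> ex_diff_n u n x t.

(* (x, t) |-> (P x t, Q x t) is a diffeomorphism of the open set D onto the
   open set D', with inverse (y, s) |-> (G y s, H y s). *)
Definition diffeomorphism (D D' : R * R -> Prop) (P Q : R -> R -> R) : Prop :=
  open D /\ open D' /\ smooth_on D P /\ smooth_on D Q /\
  (forall x t, D (x, t) -> D' (P x t, Q x t)) /\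
  exists G H : R -> R -> R,
    smooth_on D' G /\ smooth_on D' H /\
    (forall y s, D' (y, s) -> D (G y s, H y s)) /\
    (forall x t, D (x, t) ->
       G (P x t) (Q x t) = x /\ H (P x t) (Q x t) = t) /\
    (forall y s, D' (y, s) ->
       P (G y s) (H y s) = y /\ Q (G y s) (H y s) = s).

(* E u x t: the function u satisfies the equation E at the point (x, t). *)
Definition equation : Type := (R -> R -> R) -> R -> R -> Prop.

Definition satisfies_on (D : R * R -> Prop) (E : equation)
    (u : R -> R -> R) : Prop :=
  forall x t, D (x, t) -> E u x t.

(* The transformation x' = P(x,t), t' = Q(t), u' = S(x,t,u), considered over
   open subsets D of Omega, maps the equation E' into the equation E. *)
Definition maps_into (Omega : R * R -> Prop)
    (P : R -> R -> R) (Q : R -> R) (S : R -> R -> R -> R)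
    (E' E : equation) : Prop :=
  forall (D D' : R * R -> Prop) (u u' : R -> R -> R),
    (forall p, D p -> Omega p) ->
    diffeomorphism D D' P (fun _ t => Q t) ->
    smooth_on D u ->
    (forall x t, D (x, t) -> u x t <> 0) ->
    (forall x t, D (x, t) -> u' (P x t) (Q t) = S x t (u x t)) ->
    (satisfies_on D' E' u' <-> satisfies_on D E u).

Definition eq_target : equation := fun u x t =>
  Dt u x t = Dx (fun y s => Dx u y s / u y s) x t
             + 1 / (x * u x t) * Dx u x t.

Definition eq_i : equation := fun u x t =>
  Dt u x t = Dx (fun y s => Dx u y s / u y s) x t.

Definition eq_ii : equation := fun u x t =>
  Dt u x t = Dx (fun y s => Dx u y s / u y s) x t
             + (1 / (x * u x t) + 1 / 2 * x) * Dx u x t.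

Definition eq_iii : equation := fun u x t =>
  Dt u x t = Dx (fun y s => Dx u y s / u y s) x t
             + 1 / 2 * x * Dx u x t.

(* Main.v *)
From Stdlib Require Import Reals Lra.
From Coquelicot Require Import Coquelicot.
Require Import Defs.
Open Scope R_scope.

(** Every equation involved reads v_s = (v_y / v)_y + A(y) v_y / v + B(y) v_y.
    The three transformations are treated by one computation in the inverse
    variables: near the image of a point, write x = X(y, s), t = T(s), so that
    v(y, s) = w(X) u(X, T) with w a multiple of a power x^nu.  Suppose that
    X_y = a X, X_s = B a X and a_y = - A a for some function a(y, s).  With
    L = u_x / u one finds
      v_y / v       = a (nu + X L),
      (v_y / v)_y   = - A a (nu + X L) + a^2 X (L + X L_x),
      v_s           = w T' u_t + B v_y.
    In the equation for v the terms in A and B cancel, and there remains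
      w T' u_t = a^2 X (L + X L_x).
    If moreover w T' = (a X)^2, dividing by this nonzero factor leaves
    u_t = L_x + L / X, which is the target equation.  This equivalence at a
    single point is [drift_diffusion_pullback]; since a diffeomorphism is onto,
    it yields the equivalence on the whole domains in [maps_into_of_branches].

    It remains to exhibit X, T and a.  For (i) and (iii), y = k ln|x| / g(s)
    with g = 1 and g = exp (s/2), which gives a = g / k
    ([logarithmic_branch]).  For (ii), y = x^k / exp (s/2), which gives
    X = (y exp (s/2))^(1/k) and a = 1 / (k y) ([power_branch]).

    The function u' is given only through u: its derivatives exist because it is
    locally w(X) times the composite of u with the inverse branch. *)

(** * Equations with drift and inverse branches *)

Definition drift_diffusion (A B : R -> R) : equation := fun v y s =>
  Dt v y s = Dx (fun y s => Dx v y s / v y s) y s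
             + A y * (Dx v y s / v y s) + B y * Dx v y s.

(** At the point (y, s), the pair (X, T) inverts (P, Q) and satisfies the
    differential relations under which v = w(X) u(X, T) obeys the equation with
    drifts A and B exactly when u obeys the target equation.  The function a is
    the logarithmic derivative X_y / X and tau is T'.  The condition branch_w
    says that w is homogeneous of degree nu. *)
Record inverse_branch (P : R -> R -> R) (Q w : R -> R) (nu : R) (A B : R -> R)
    (X : R -> R -> R) (T : R -> R) (a : R -> R -> R) (tau : R -> R)
    (y s : R) : Prop := {
  branch_P : P (X y s) (T s) = y;
  branch_Q : Q (T s) = s;
  branch_neq : X y s <> 0;
  branch_rate_neq : a y s <> 0;
  branch_cont : continuity_2d_pt X y s;
  branch_Xy : is_derive (fun z => X z s) y (a y s * X y s);
  branch_Xs : is_derive (fun r => X y r) s (B y * a y s * X y s);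
  branch_T : is_derive T s (tau s);
  branch_ay : is_derive (fun z => a z s) y (- A y * a y s);
  branch_w : is_derive w (X y s) (nu * w (X y s) / X y s);
  branch_scale : w (X y s) * tau s = (a y s * X y s) ^ 2 }.

(** The branch must return to (x, t) itself: in the logarithmic cases (P, Q) is
    not injective, as x and -x have the same image, so the branch depends on
    the base point. *)
Definition has_inverse_branch (P : R -> R -> R) (Q w : R -> R) (nu : R)
    (A B : R -> R) (x t : R) : Prop :=
  exists X T a tau, X (P x t) (Q t) = x /\ T (Q t) = t /\
    locally_2d (inverse_branch P Q w nu A B X T a tau) (P x t) (Q t).

(** * Smooth functions on open sets *)

Lemma locally_2d_open_preimage (D : R * R -> Prop) (X : R -> R -> R)
    (T : R -> R) (y s : R) :
  open D -> continuity_2d_pt X y s -> continuous T s -> D (X y s, T s) ->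
  locally_2d (fun z r => D (X z r, T r)) y s.
Proof.
intros openD contX contT DXT.
apply locally_2d_locally.
assert (contXT : filterlim (fun p : R * R => (X (fst p) (snd p), T (snd p)))
          (locally (y, s)) (locally (X y s, T s))).
{ assert (lim : filterlim (fun p : R * R => (X (fst p) (snd p), T (snd p)))
      (locally (y, s)) (filter_prod (locally (X y s)) (locally (T s)))).
  { apply filterlim_pair.
    - now apply continuity_2d_pt_filterlim.
    - apply (continuous_comp (snd : R * R -> R) T (y, s)); [| exact contT].
      apply continuous_snd. }
  apply (filterlim_filter_le_2 _ (G := filter_prod (locally (X y s)) (locally (T s)))).
  2: exact lim.
  intros S [eps HS].
  exists (fun z => ball (X y s) eps z) (fun z => ball (T s) eps z).
  - now exists eps.
  - now exists eps.
  - intros z r Hz Hr. apply HS. now split. }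
apply contXT.
now apply openD.
Qed.

Lemma open_locally_2d (D : R * R -> Prop) (x t : R) :
  open D -> D (x, t) -> locally_2d (fun z r => D (z, r)) x t.
Proof.
intros openD Dxt.
apply (locally_2d_open_preimage D (fun z _ => z) (fun r => r)); trivial.
- apply continuity_2d_pt_id1.
- apply continuous_id.
Qed.

Lemma smooth_on_derive_x D u x t :
  smooth_on D u -> D (x, t) -> is_derive (fun z => u z t) x (Dx u x t).
Proof.
intros smu Dxt. apply Derive_correct. now destruct (smu 1%nat x t Dxt) as (_ & H & _).
Qed.

Lemma smooth_on_derive_t D u x t :
  smooth_on D u -> D (x, t) -> is_derive (fun r => u x r) t (Dt u x t).
Proof.
intros smu Dxt. apply Derive_correct. now destruct (smu 1%nat x t Dxt) as (_ & _ & H & _).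
Qed.

Lemma smooth_on_Dx D u : smooth_on D u -> smooth_on D (Dx u).
Proof.
intros smu n x t Dxt. now destruct (smu (S n) x t Dxt) as (_ & _ & _ & H & _).
Qed.

(** Needed for the s-derivative of u (X y s) (T s), where both arguments move:
    continuity of one partial derivative makes u differentiable in the two
    variables jointly. *)
Lemma smooth_on_differentiable D u x t :
  open D -> smooth_on D u -> D (x, t) ->
  differentiable_pt_lim u x t (Dx u x t) (Dt u x t).
Proof.
intros openD smu Dxt.
apply filterdiff_differentiable_pt_lim.
apply (is_derive_filterdiff u x t (Dx u) (Dt u x t)).
- apply (locally_2d_locally (fun z r => is_derive (fun q => u q r) z (Dx u z r))).
  apply locally_2d_impl with (2 := open_locally_2d D x t openD Dxt).
  apply locally_2d_forall. intros z r Dzr. now apply smooth_on_derive_x with D.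
- now apply smooth_on_derive_t with D.
- apply (proj1 (continuity_2d_pt_filterlim (Dx u) x t)).
  now destruct (smooth_on_Dx D u smu 0%nat x t Dxt).
Qed.

(** * Pulling the equation back along a branch *)

(** The two sides of the equation for v differ by (a X)^2 times the difference
    of the two sides of the target equation, because the terms in A and B cancel. *)
Lemma drift_diffusion_pullback (P : R -> R -> R) (Q w : R -> R) (nu : R) (A B : R -> R)
    (X : R -> R -> R) (T : R -> R) (a : R -> R -> R) (tau : R -> R)
    (D : R * R -> Prop) (u v : R -> R -> R) (y s : R) :
  open D -> smooth_on D u -> (forall x t, D (x, t) -> u x t <> 0) ->
  (forall x t, D (x, t) -> v (P x t) (Q t) = w x * u x t) ->
  D (X y s, T s) ->
  locally_2d (inverse_branch P Q w nu A B X T a tau) y s ->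
  drift_diffusion A B v y s <-> eq_target u (X y s) (T s).
Proof.
intros openD smu unz vdef DXT branch.
set (L := fun x t => Dx u x t / u x t).
assert (branch0 := locally_2d_singleton _ _ _ branch).
(* Near (y, s) the branch relations hold and (X, T) stays in D; there v is the
   product of w and u along the branch, which gives access to its derivatives. *)
assert (good : locally_2d (fun z r => D (X z r, T r) /\
    inverse_branch P Q w nu A B X T a tau z r) y s).
{ apply locally_2d_and; [| exact branch].
  apply locally_2d_open_preimage; trivial.
  - apply branch0.
  - apply @ex_derive_continuous. exists (tau s). apply branch0. }
assert (vE : locally_2d (fun z r => v z r = w (X z r) * u (X z r) (T r)) y s).
{ apply locally_2d_impl with (2 := good). apply locally_2d_forall.
  intros z r [DXTz b]. rewrite <- vdef by exact DXTz.
  now rewrite (branch_P _ _ _ _ _ _ _ _ _ _ _ _ b), (branch_Q _ _ _ _ _ _ _ _ _ _ _ _ b). }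
assert (wnz : forall z r, inverse_branch P Q w nu A B X T a tau z r -> w (X z r) <> 0).
{ intros z r b w0. destruct b. rewrite w0 in branch_scale0.
  assert (H : (a z r * X z r) ^ 2 <> 0) by (apply pow_nonzero, Rmult_integral_contrapositive_currified; trivial).
  lra. }
(* v_y / v is needed on a neighbourhood, since it is differentiated again. *)
assert (vyE : locally_2d (fun z r => Dx v z r / v z r = a z r * (nu + X z r * L (X z r) (T r))) y s).
{ assert (both := locally_2d_and _ _ _ _ good vE).
  apply locally_2d_impl_strong with (2 := both). apply locally_2d_forall.
  intros z r near. destruct (locally_2d_singleton _ _ _ near) as [[DXTz b] vz].
  assert (wz := wnz z r b). assert (uz := unz _ _ DXTz).
  assert (dv : is_derive (fun q => v q r) z
            (v z r * (a z r * (nu + X z r * L (X z r) (T r))))).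
  { apply (is_derive_ext_loc (fun q => w (X q r) * u (X q r) (T r))).
    { apply (locally_2d_1d_const_y (fun q r => w (X q r) * u (X q r) (T r) = v q r)).
      apply locally_2d_impl with (2 := near). apply locally_2d_forall.
      intros q r' [_ H]. now symmetry. }
    evar_last.
    { apply (is_derive_mult (fun q => w (X q r)) (fun q => u (X q r) (T r))).
      - apply (is_derive_comp w (fun q => X q r)); apply b.
      - apply (is_derive_comp (fun x => u x (T r)) (fun q => X q r)); [| apply b].
        now apply smooth_on_derive_x with D.
      - intros; apply Rmult_comm. }
    unfold L, scal, plus, mult; simpl; unfold mult; simpl.
    rewrite vz. destruct b. field. now split. }
  assert (Dxv : Dx v z r = v z r * (a z r * (nu + X z r * L (X z r) (T r))))
    by exact (is_derive_unique _ _ _ dv).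
  rewrite Dxv, vz. field. now split. }
pose proof branch0 as [_ _ Xnz anz _ dXy dXs dT day dw sc].
assert (uz := unz _ _ DXT). assert (wz := wnz y s branch0).
assert (vz := locally_2d_singleton _ _ _ vE). simpl in vz.
assert (dL : is_derive (fun x => L x (T s)) (X y s) (Dx L (X y s) (T s))).
{ apply Derive_correct. eexists. apply is_derive_div; [| | exact uz].
  - apply smooth_on_derive_x with D; [now apply smooth_on_Dx | exact DXT].
  - now apply smooth_on_derive_x with D. }
assert (flux : Dx (fun y s => Dx v y s / v y s) y s
    = - A y * a y s * (nu + X y s * L (X y s) (T s))
      + (a y s) ^ 2 * X y s * (L (X y s) (T s) + X y s * Dx L (X y s) (T s))).
{ unfold Dx at 1. apply is_derive_unique.
  apply (is_derive_ext_loc (fun z => a z s * (nu + X z s * L (X z s) (T s)))).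
  { apply (locally_2d_1d_const_y (fun z s => a z s * (nu + X z s * L (X z s) (T s)) = Dx v z s / v z s)).
    apply locally_2d_impl with (2 := vyE). apply locally_2d_forall. intros; now symmetry. }
  evar_last.
  { apply (is_derive_mult (fun z => a z s) (fun z => nu + X z s * L (X z s) (T s)));
      [exact day | | intros; apply Rmult_comm].
    apply (is_derive_plus (fun _ => nu) (fun z => X z s * L (X z s) (T s)));
      [apply is_derive_const |].
    apply (is_derive_mult (fun z => X z s) (fun z => L (X z s) (T s)));
      [exact dXy | | intros; apply Rmult_comm].
    exact (is_derive_comp (fun x => L x (T s)) (fun z => X z s) y _ _ dL dXy). }
  unfold scal, plus, mult, zero; simpl; unfold mult; simpl. ring. }
assert (vyE0 := locally_2d_singleton _ _ _ vyE). simpl in vyE0.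
assert (vtE : Dt v y s = w (X y s) * tau s * Dt u (X y s) (T s)
    + B y * (v y s * (Dx v y s / v y s))).
{ unfold Dt at 1. apply is_derive_unique.
  apply (is_derive_ext_loc (fun r => w (X y r) * u (X y r) (T r))).
  { apply (locally_2d_1d_const_x (fun z r => w (X z r) * u (X z r) (T r) = v z r)).
    apply locally_2d_impl with (2 := vE). apply locally_2d_forall. intros; now symmetry. }
  evar_last.
  { apply (is_derive_mult (fun r => w (X y r)) (fun r => u (X y r) (T r)));
      [ | | intros; apply Rmult_comm].
    - exact (is_derive_comp w (fun r => X y r) s _ _ dw dXs).
    - apply is_derive_Reals.
      apply (derivable_pt_lim_comp_2d u (fun r => X y r) T).
      + now apply smooth_on_differentiable with D.
      + apply is_derive_Reals; exact dXs.
      + apply is_derive_Reals; exact dT. }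
  rewrite vyE0, vz.
  unfold L, scal, plus, mult; simpl; unfold mult; simpl. field. now split. }
assert (vnz : v y s <> 0) by (rewrite vz; now apply Rmult_integral_contrapositive_currified).
assert (BE : B y * (v y s * (Dx v y s / v y s)) = B y * Dx v y s) by (field; exact vnz).
unfold drift_diffusion, eq_target. fold L.
change (fun y s => Dx u y s / u y s) with L.
rewrite flux, vtE, BE, vyE0, sc.
(* The target equation is compared after multiplication by (a X)^2. *)
assert (residual : forall l r : R, l = r <-> (a y s * X y s) ^ 2 * l = (a y s * X y s) ^ 2 * r).
{ intros l r; split; [now intros -> |].
  intros H; apply Rmult_eq_reg_l with (1 := H).
  now apply pow_nonzero, Rmult_integral_contrapositive_currified. }
rewrite (residual (Dt u _ _)).
assert (rhs : (a y s * X y s) ^ 2 * (Dx L (X y s) (T s)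
        + 1 / (X y s * u (X y s) (T s)) * Dx u (X y s) (T s))
   = (a y s) ^ 2 * X y s * (L (X y s) (T s) + X y s * Dx L (X y s) (T s))).
{ unfold L at 2. field. now split. }
rewrite rhs. split; intros H; lra.
Qed.

(** The pointwise equivalence transfers solutions from D' to D because (P, Q)
    maps D into D', and from D to D' because every point of D' is an image. *)
Lemma maps_into_of_branches (Omega : R * R -> Prop) (P : R -> R -> R) (Q : R -> R)
    (S : R -> R -> R -> R) (w : R -> R) (nu : R) (A B : R -> R) (E' : equation) :
  (forall v y s, E' v y s <-> drift_diffusion A B v y s) ->
  (forall x t u, S x t u = w x * u) ->
  (forall x t, Omega (x, t) -> has_inverse_branch P Q w nu A B x t) ->
  maps_into Omega P Q S E' eq_target.
Proof.
intros HE' HS branches D D' u u' DOmega diffeo smu unz u'def.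
destruct diffeo as (openD & _ & _ & _ & PQ & G & H & _ & _ & DGH & _ & PQGH).
assert (pointwise : forall x t, D (x, t) -> E' u' (P x t) (Q t) <-> eq_target u x t).
{ intros x t Dxt. rewrite HE'.
  destruct (branches x t (DOmega _ Dxt)) as (X & T & a & tau & Xx & Tt & br).
  assert (equiv := drift_diffusion_pullback P Q w nu A B X T a tau D u u' (P x t) (Q t)).
  rewrite Xx, Tt in equiv. apply equiv; trivial.
  intros z r Dzr. now rewrite u'def, HS. }
split.
- intros sol x t Dxt. now apply pointwise, sol, PQ.
- intros sol y s D'ys. assert (Dxt := DGH y s D'ys).
  destruct (PQGH y s D'ys) as [Py Qs].
  assert (E'u' := proj2 (pointwise _ _ Dxt) (sol _ _ Dxt)).
  now rewrite Py, Qs in E'u'.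
Qed.

(** * The branches of the three transformations *)

Lemma derive_square_weight (c x : R) : x <> 0 ->
  is_derive (fun x => c * x ^ 2) x (2 * (c * x ^ 2) / x).
Proof. intros xnz. auto_derive; [easy | now field]. Qed.

Lemma continuity_2d_pt_exp (f : R -> R -> R) (y s : R) :
  continuity_2d_pt f y s -> continuity_2d_pt (fun y s => exp (f y s)) y s.
Proof.
apply continuity_1d_2d_pt_comp, derivable_continuous_pt, derivable_pt_exp.
Qed.

Lemma continuity_2d_pt_snd (g : R -> R) (y s : R) :
  ex_derive g s -> continuity_2d_pt (fun _ r => g r) y s.
Proof.
intros dg. apply (continuity_1d_2d_pt_comp g (fun _ r => r)).
- apply derivable_continuous_pt. now apply ex_derive_Reals_0.
- apply continuity_2d_pt_id2.
Qed.

(** Solving y = k ln|z| / g(s) for z gives z = x exp (y g(s) / k - ln|x|) near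
    the base point x: written this way, with the sign carried by x, one formula
    serves both half-lines.  Here a = g / k does not depend on y, so A = 0,
    while X_s / X = y g' / k = (b y) a by g' = b g.  The relation
    w T' = (a X)^2 amounts to T' = g^2. *)
Lemma logarithmic_branch (k b : R) (P : R -> R -> R) (Q T tau g : R -> R) (x t : R) :
  k <> 0 -> x <> 0 ->
  (forall s, g s <> 0) ->
  (forall s, is_derive g s (b * g s)) ->
  (forall s, Q (T s) = s) ->
  T (Q t) = t ->
  (forall s, is_derive T s (tau s)) ->
  (forall s, tau s = g s ^ 2) ->
  (forall z s, P z (T s) = k * ln (Rabs z) / g s) ->
  has_inverse_branch P Q (fun z => 1 / k ^ 2 * z ^ 2) 2
    (fun _ => 0) (fun y => b * y) x t.
Proof.
intros knz xnz gnz dg QT TQ dT tauE PE.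
set (phi := fun y s => y * g s / k - ln (Rabs x)).
exists (fun y s => x * exp (phi y s)), T, (fun _ s => g s / k), tau.
split; [| split; [exact TQ |]].
{ replace (phi (P x t) (Q t)) with 0; [rewrite exp_0; ring |].
  assert (Pxt : P x t = k * ln (Rabs x) / g (Q t)) by now rewrite <- PE, TQ.
  unfold phi. rewrite Pxt. field. now split. }
apply locally_2d_forall. intros y s.
assert (Xnz : x * exp (phi y s) <> 0).
{ apply Rmult_integral_contrapositive_currified; [exact xnz |].
  apply Rgt_not_eq, exp_pos. }
split; auto.
- rewrite PE, Rabs_mult, (Rabs_pos_eq (exp _)) by (left; apply exp_pos).
  rewrite ln_mult, ln_exp by (try apply exp_pos; now apply Rabs_pos_lt).
  unfold phi. field. now split.
- apply Rmult_integral_contrapositive_currified; [apply gnz | now apply Rinv_neq_0_compat].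
- apply continuity_2d_pt_mult; [apply continuity_2d_pt_const |].
  apply continuity_2d_pt_exp, continuity_2d_pt_minus; [| apply continuity_2d_pt_const].
  apply continuity_2d_pt_mult; [| apply continuity_2d_pt_const].
  apply continuity_2d_pt_mult; [apply continuity_2d_pt_id1 |].
  apply continuity_2d_pt_snd. eexists; apply dg.
- unfold phi. auto_derive; [easy |]. unfold Rminus, Rdiv. ring.
- unfold phi. auto_derive; [now exists (b * g s) |].
  replace (Derive (fun r : R => g r) s) with (b * g s) by (symmetry; exact (is_derive_unique _ _ _ (dg s))).
  unfold Rminus, Rdiv. ring.
- evar_last; [apply is_derive_const |]. unfold zero; simpl. ring.
- now apply derive_square_weight.
- rewrite tauE. field. exact knz.
Qed.

(** With ln t = s, solving y = x^k / exp (s/2) gives X = exp ((ln y + s/2) / k).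
    Then a = X_y / X = 1 / (k y), so a_y = - a / y, and
    X_s / X = 1 / (2 k) = (y / 2) a.  Finally
    w T' = X^(2 - 2 k) exp s / k^2 = X^2 / (k y)^2, as X^k = y exp (s/2). *)
Lemma power_branch (k x t : R) :
  k <> 0 -> 0 < x -> 0 < t ->
  has_inverse_branch (fun x t => Rpower x k / sqrt t) (fun t => ln t)
    (fun z => 1 / k ^ 2 * Rpower z (2 * (1 - k))) (2 * (1 - k))
    (fun y => 1 / y) (fun y => 1 / 2 * y) x t.
Proof.
intros knz xpos tpos.
assert (sqrt_exp : forall s, sqrt (exp s) = exp (s / 2)).
{ intros s. apply sqrt_lem_1; try (left; apply exp_pos).
  rewrite <- exp_plus. f_equal. field. }
assert (exp_div : forall p q, exp p / exp q = exp (p - q)).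
{ intros p q. unfold Rminus, Rdiv. now rewrite exp_plus, exp_Ropp. }
assert (Ppos : 0 < Rpower x k / sqrt t).
{ apply Rdiv_lt_0_compat; [apply exp_pos | now apply sqrt_lt_R0]. }
exists (fun y s => exp ((ln y + s / 2) / k)), exp, (fun y _ => 1 / (k * y)), exp.
split; [| split; [now apply exp_ln |]].
{ rewrite <- (exp_ln t tpos) at 1. rewrite sqrt_exp.
  unfold Rpower. rewrite exp_div, ln_exp.
  rewrite <- (exp_ln x xpos) at 2. f_equal. field. exact knz. }
(* ln y is only differentiable for y > 0, which holds near the base point. *)
assert (nbhd : locally_2d (fun y _ => 0 < y) (Rpower x k / sqrt t) (ln t)).
{ exists (mkposreal _ Ppos). simpl. intros y s Hy _. apply Rabs_lt_between in Hy. lra. }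
apply locally_2d_impl with (2 := nbhd). apply locally_2d_forall. intros y s ypos.
assert (ynz : y <> 0) by lra.
split.
- rewrite sqrt_exp. unfold Rpower. rewrite exp_div, ln_exp.
  rewrite <- (exp_ln y ypos) at 2. f_equal. field. exact knz.
- apply ln_exp.
- apply Rgt_not_eq, exp_pos.
- unfold Rdiv. rewrite Rmult_1_l.
  now apply Rinv_neq_0_compat, Rmult_integral_contrapositive_currified.
- apply continuity_2d_pt_exp, continuity_2d_pt_mult; [| apply continuity_2d_pt_const].
  apply continuity_2d_pt_plus.
  + apply (continuity_1d_2d_pt_comp ln (fun y _ => y)); [| apply continuity_2d_pt_id1].
    apply derivable_continuous_pt. now exists (/ y); apply derivable_pt_lim_ln.
  + apply continuity_2d_pt_mult; [apply continuity_2d_pt_id2 | apply continuity_2d_pt_const].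
- auto_derive; [exact ypos |]. unfold Rdiv. field. now split.
- auto_derive; [easy |]. unfold Rdiv. field. now split.
- auto_derive; [easy | ring].
- auto_derive; [now apply Rmult_integral_contrapositive_currified |]. field. now split.
- unfold Rpower. auto_derive; [apply exp_pos |]. field.
  split; [exact knz | apply Rgt_not_eq, exp_pos].
- assert (XE : Rpower (exp ((ln y + s / 2) / k)) (2 * (1 - k)) * exp s
             = exp ((ln y + s / 2) / k) ^ 2 / y ^ 2).
  { rewrite <- (exp_ln y ypos) at 3.
    unfold Rpower. rewrite ln_exp. simpl. rewrite !Rmult_1_r.
    rewrite <- !exp_plus, exp_div. f_equal. field. exact knz. }
  rewrite Rmult_assoc, XE. field. now split.
Qed.

Theorem mainTheorem2 (k : R) (hk : k <> 0) :
  maps_into (fun p => fst p <> 0)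
    (fun x t => k * ln (Rabs x))
    (fun t => t)
    (fun x t u => 1 / k ^ 2 * u * x ^ 2)
    eq_i eq_target
  /\
  maps_into (fun p => 0 < fst p /\ 0 < snd p)
    (fun x t => Rpower x k / sqrt t)
    (fun t => ln t)
    (fun x t u => 1 / k ^ 2 * u * Rpower x (2 * (1 - k)))
    eq_ii eq_target
  /\
  maps_into (fun p => fst p <> 0 /\ 0 < snd p)
    (fun x t => k * ln (Rabs x) / sqrt t)
    (fun t => ln t)
    (fun x t u => 1 / k ^ 2 * u * x ^ 2)
    eq_iii eq_target.
Proof.
split; [| split].
- apply (maps_into_of_branches _ _ _ _ (fun z => 1 / k ^ 2 * z ^ 2) 2
           (fun _ => 0) (fun y => 0 * y)).
  + intros v y s. unfold eq_i, drift_diffusion. rewrite !Rmult_0_l, !Rplus_0_r. easy.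
  + intros; ring.
  + intros x t xnz. apply (logarithmic_branch k 0 _ _ (fun s => s) (fun _ => 1) (fun _ => 1)); auto.
    * intros s. auto_derive; [easy | ring].
    * intros s. auto_derive; [easy | ring].
    * intros; ring.
    * intros; field.
- apply (maps_into_of_branches _ _ _ _ (fun z => 1 / k ^ 2 * Rpower z (2 * (1 - k)))
           (2 * (1 - k)) (fun y => 1 / y) (fun y => 1 / 2 * y)).
  + intros v y s. unfold eq_ii, drift_diffusion.
    replace ((1 / (y * v y s) + 1 / 2 * y) * Dx v y s)
      with (1 / y * (Dx v y s / v y s) + 1 / 2 * y * Dx v y s)
      by (unfold Rdiv; rewrite Rinv_mult; ring).
    now rewrite Rplus_assoc.
  + intros; ring.
  + intros x t [xpos tpos]. now apply power_branch.
- apply (maps_into_of_branches _ _ _ _ (fun z => 1 / k ^ 2 * z ^ 2) 2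
           (fun _ => 0) (fun y => 1 / 2 * y)).
  + intros v y s. unfold eq_iii, drift_diffusion. now rewrite Rmult_0_l, Rplus_0_r.
  + intros; ring.
  + intros x t [xnz tpos].
    apply (logarithmic_branch k (1 / 2) _ _ exp exp (fun s => exp (s / 2))); auto.
    * intros s. apply Rgt_not_eq, exp_pos.
    * intros s. auto_derive; [easy |]. unfold Rdiv. ring.
    * apply ln_exp.
    * now apply exp_ln.
    * intros s. auto_derive; [easy | ring].
    * intros s. simpl. rewrite Rmult_1_r, <- exp_plus. f_equal. field.
    * intros z s. f_equal. apply sqrt_lem_1; try (left; apply exp_pos).
      rewrite <- exp_plus. f_equal. field.
Qed.
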